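(* Let the system, constraints, cost, horizon $N\ge 1$ and functions $\rho$, $V_f$, $\lambda$ be as in the context, and suppose: (A1) the parameter set $\Theta$ is compact; (A2) the storage function $\lambda(\theta,x)$ is continuous on $\Theta\times\mathbb{X}$; (A3) there exist a compact terminal region $\mathbb{X}_f\subseteq\mathbb{X}$ with $x^s$ as an interior point, a terminal policy $\kappa_f:\mathbb{X}\to\mathbb{U}$ with $\kappa_f(x^s)=u^s$, and a continuous terminal penalty $V_f:\mathbb{X}_f\to\mathbb{R}$ (these $\mathbb{X}_f$ and $V_f$ are the ones used in the optimisation problem), such that for all $x\in\mathbb{X}_f$: (i) $(x,\kappa_f(x))\in\mathbb{Z}$; (ii) $f(x,\kappa_f(x))\in\mathbb{X}_f$; (iii) $V_f(f(x,\kappa_f(x)))-V_f(x)\le\ell(x^s,u^s)-\ell(x,\kappa_f(x))$; (A4) for all $x\in\mathbb{X}_f$ and all $\theta\in\Theta$ there exists $\theta^+\in\Theta$ such that $$\lambda(\theta^+,f(x,\kappa_f(x)))-\lambda(\theta,x)\le \ell(x,\kappa_f(x))-\ell(x^s,u^s)-\rho(x-x^s).$$ Then, for every initial condition $(x_0,\theta_0)\in\mathcal{X}_N$, the asymptotic average performance of the closed-loop system under the EMPC controller fulfils $$\limsup_{T\to+\infty}\frac{\sum_{t=0}^{T-1}\ell(x^*_{t|t},u^*_{t|t})}{T}\le\ell(x^s,u^s).$$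
   Context: System: $x_{t+1}=f(x_t,u_t)$ with state $x\in\mathbb{X}\subseteq\mathbb{R}^n$, input $u\in\mathbb{U}\subseteq\mathbb{R}^m$, and continuous $f:\mathbb{X}\times\mathbb{U}\to\mathbb{X}$. Constraints: $(x_t,u_t)\in\mathbb{Z}$ for all $t\ge0$, where $\mathbb{Z}\subseteq\mathbb{X}\times\mathbb{U}$ is compact. The stage cost $\ell:\mathbb{Z}\to\mathbb{R}$ is continuous. The optimal steady state is $(x^s,u^s)=\arg\min\{\ell(x,u)\mid (x,u)\in\mathbb{Z},\ x=f(x,u)\}$, assumed to exist and be unique. $\Theta$ is a set of (finite-dimensional real) parameters and $\lambda:\Theta\times\mathbb{X}\to\mathbb{R}$ is a parameter-varying storage function. $\rho:\mathbb{R}^n\to\mathbb{R}_{\ge0}$ is a fixed positive definite function: continuous, $\rho(0)=0$, $\rho(z)>0$ for $z\ne0$. EMPC optimisation problem $\mathcal{P}_N(x_t,\theta_t)$ at time $t$, with horizon $N\in\mathbb{Z}_{\ge1}$ (here $\mathbb{Z}_{\geq 1}$ denotes the positive integers): minimise $$J_N=\sum_{k=t}^{t+N-1}\ell(x_{k|t},u_{k|t})+V_f(x_{t+N|t})$$ over sequences $(\theta_{k|t})_{k=t}^{t+N}$, $(x_{k|t})_{k=t}^{t+N}$, $(u_{k|t})_{k=t}^{t+N-1}$ subject to: $x_{t|t}=x_t$; $\theta_{t|t}=\theta_t$; for all $k=t,\dots,t+N-1$: $x_{k+1|t}=f(x_{k|t},u_{k|t})$, $(x_{k|t},u_{k|t})\in\mathbb{Z}$,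 and $$\lambda(\theta_{k+1|t},x_{k+1|t})-\lambda(\theta_{k|t},x_{k|t})+\rho(x_{k|t}-x^s)\le\ell(x_{k|t},u_{k|t})-\ell(x^s,u^s);$$ $\theta_{k|t}\in\Theta$ for $k=t,\dots,t+N$; and $x_{t+N|t}\in\mathbb{X}_f$. $\mathcal{X}_N$ is the set of $(x,\theta)\in\mathbb{X}\times\Theta$ for which $\mathcal{P}_N(x,\theta)$ has a feasible solution. Closed loop: at each time $t$ an optimal solution (marked by $*$) of $\mathcal{P}_N(x_t,\theta_t)$ is computed, and $x_{t+1}=f(x_t,u^*_{t|t})$, $\theta_{t+1}=\theta^*_{t+1|t}$; in particular $x^*_{t|t}=x_t$. *)

(* Defs.v *)
From HB Require Import structures.
From mathcomp Require Import all_boot all_order all_algebra.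
From mathcomp Require Import all_classical all_reals all_analysis.

Set Implicit Arguments.
Unset Strict Implicit.
Unset Printing Implicit Defensive.

Import Order.TTheory GRing.Theory Num.Theory.
Import numFieldNormedType.Exports.

Local Open Scope classical_set_scope.
Local Open Scope ring_scope.

(* Functions given on a subset of R^n are total functions here; their values
   outside that subset are unconstrained and continuity is only required
   {within} the subset.  Pairs are ordered as (x, u) and (theta, x). *)

Definition steady_state (R : realType) (n m : nat)
    (f : 'rV[R]_n * 'rV[R]_m -> 'rV[R]_n) (Z : set ('rV[R]_n * 'rV[R]_m)) :
    set ('rV[R]_n * 'rV[R]_m) :=
  [set z | Z z /\ z.1 = f z].

Definition optimal_steady_state (R : realType) (n m : nat)
    (f : 'rV[R]_n * 'rV[R]_m -> 'rV[R]_n) (Z : set ('rV[R]_n * 'rV[R]_m))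
    (l : 'rV[R]_n * 'rV[R]_m -> R) : set ('rV[R]_n * 'rV[R]_m) :=
  [set z | steady_state f Z z /\
           forall w, steady_state f Z w -> l z <= l w].

Definition positive_definite (R : realType) (n : nat) (rho : 'rV[R]_n -> R) :
    Prop :=
  [/\ continuous rho, rho 0 = 0 & forall z, z != 0 -> 0 < rho z].

(* Decision variables of the optimisation problem posed at time t, indexed by
   k - t.  With horizon N only theta and x at 0..N and u at 0..N-1 occur in
   the constraints and in the cost; later values are irrelevant. *)
Record plan (R : realType) (n m p : nat) := Plan {
  plan_theta : nat -> 'rV[R]_p;
  plan_x : nat -> 'rV[R]_n;
  plan_u : nat -> 'rV[R]_m }.

(* Data of the problem: dynamics f, constraint set Z, stage cost l, steady
   state (xs, us), function rho, parameter set Theta, storage function lambda,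
   terminal region Xf, terminal penalty Vf and horizon N. *)
Record empc (R : realType) (n m p : nat) := Empc {
  dyn : 'rV[R]_n * 'rV[R]_m -> 'rV[R]_n;
  constr : set ('rV[R]_n * 'rV[R]_m);
  cost : 'rV[R]_n * 'rV[R]_m -> R;
  ss_x : 'rV[R]_n;
  ss_u : 'rV[R]_m;
  pd_fun : 'rV[R]_n -> R;
  params : set 'rV[R]_p;
  storage : 'rV[R]_p * 'rV[R]_n -> R;
  term_set : set 'rV[R]_n;
  term_cost : 'rV[R]_n -> R;
  horizon : nat }.

Definition objective (R : realType) (n m p : nat) (E : empc R n m p)
    (P : plan R n m p) : R :=
  \sum_(0 <= k < horizon E) cost E (plan_x P k, plan_u P k)
    + term_cost E (plan_x P (horizon E)).

Definition feasible (R : realType) (n m p : nat) (E : empc R n m p)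
    (x : 'rV[R]_n) (theta : 'rV[R]_p) (P : plan R n m p) : Prop :=
  [/\ plan_x P 0%N = x /\ plan_theta P 0%N = theta,
      forall k, (k < horizon E)%N ->
        [/\ plan_x P k.+1 = dyn E (plan_x P k, plan_u P k),
            constr E (plan_x P k, plan_u P k) &
            storage E (plan_theta P k.+1, plan_x P k.+1)
              - storage E (plan_theta P k, plan_x P k)
              + pd_fun E (plan_x P k - ss_x E)
            <= cost E (plan_x P k, plan_u P k) - cost E (ss_x E, ss_u E)],
      forall k, (k <= horizon E)%N -> params E (plan_theta P k) &
      term_set E (plan_x P (horizon E))].

Definition optimal (R : realType) (n m p : nat) (E : empc R n m p)
    (x : 'rV[R]_n) (theta : 'rV[R]_p) (P : plan R n m p) : Prop :=
  feasible E x theta P /\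
  forall Q, feasible E x theta Q -> objective E P <= objective E Q.

Definition feasible_set (R : realType) (n m p : nat) (X : set 'rV[R]_n)
    (E : empc R n m p) : set ('rV[R]_n * 'rV[R]_p) :=
  [set z | [/\ X z.1, params E z.2 & exists P, feasible E z.1 z.2 P]].

(* The controller is only required to return an optimal plan when the problem
   is feasible, so recursive feasibility along the closed loop is not part of
   this definition. *)
Definition closed_loop (R : realType) (n m p : nat) (X : set 'rV[R]_n)
    (E : empc R n m p) (x : nat -> 'rV[R]_n) (theta : nat -> 'rV[R]_p)
    (P : nat -> plan R n m p) : Prop :=
  forall t : nat,
    [/\ feasible_set X E (x t, theta t) -> optimal E (x t) (theta t) (P t),
        x t.+1 = dyn E (x t, plan_u (P t) 0%N) &
        theta t.+1 = plan_theta (P t) 1%N].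

(* Main.v *)
(* Shifting an optimal plan by one step and appending the terminal policy, with
   the parameter supplied by (A4), is feasible at the next state, and by (A3.iii)
   costs at most the old value minus the stage cost just paid plus the
   steady-state cost.  Telescoping, the sum of T stage costs exceeds T times the
   steady-state cost by at most the initial value minus a lower bound of the
   objective, which exists because Z and X_f are compact. *)

Require Import Defs.
From HB Require Import structures.
From mathcomp Require Import all_boot all_order all_algebra.
From mathcomp Require Import all_classical all_reals all_analysis.
From mathcomp Require Import ring lra.
Import Order.TTheory GRing.Theory Num.Theory.
Import numFieldNormedType.Exports.
Local Open Scope classical_set_scope.
Local Open Scope ring_scope.

(** The limit superior is an infimum of suprema over the sets of the filter, and the set where the
    bound holds is itself one of them. *)
Lemma limn_esup_le_near (R : realType) (u : nat -> \bar R) (c : \bar R) :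
  (\forall k \near \oo, (u k <= c)%E) -> (limn_esup u <= c)%E.
Proof.
move=> uc; rewrite /limn_esup /limf_esup.
apply: (@le_trans _ _ (ereal_sup (u @` [set k | (u k <= c)%E]))).
  by apply: ereal_inf_lbound; exists [set k | (u k <= c)%E].
by apply: ge_ereal_sup => _ [k uk <-].
Qed.

Lemma limn_esup_average_le (R : realType) (a : nat -> R) (c K : R) :
  (forall T, \sum_(0 <= t < T) a t <= T%:R * c + K) ->
  (limn_esup (fun T => ((\sum_(0 <= t < T) a t) / T%:R)%:E) <= c%:E)%E.
Proof.
move=> aK; apply/lee_addgt0Pr => e e0; apply: limn_esup_le_near.
near=> T; rewrite -EFinD lee_fin.
have T0 : 0 < T%:R :> R by rewrite ltr0n; near: T; exact: nbhs_infty_gt.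
rewrite ler_pdivrMr// (le_trans (aK T))// mulrDl [T%:R * c]mulrC lerD2l.
(* Only [K <= e * T] is left, which holds once [T] exceeds [K / e]. *)
rewrite mulrC -ler_pdivrMr//.
by near: T; exact: nbhs_infty_ger.
Unshelve. all: by end_near. Qed.

Lemma within_continuous_lbound (R : realType) (T : topologicalType)
    (g : T -> R) (A : set T) :
  compact A -> {within A, continuous g} ->
  exists b, forall z, A z -> b <= g z.
Proof.
move=> cA cg; have [M [_ gM]] := compact_bounded (continuous_compact cg cA).
(* Boundedness is available only for constants strictly above [M], hence [M + 1]. *)
exists (- (M + 1)) => z Az.
have /gM : M < M + 1 by rewrite ltrDl.
by move=> /(_ (g z) (imageP _ Az)) /=; rewrite ler_norml => /andP[].
Qed.

(** States and parameters have one entry more than inputs, hence the two cutoffs. The appended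
    values also fill the irrelevant later indices. *)
Definition shift_plan {R : realType} {n m p : nat} (N : nat) (P : plan R n m p)
    (theta' : 'rV[R]_p) (x' : 'rV[R]_n) (u' : 'rV[R]_m) : plan R n m p :=
  Plan (fun k => if (k < N)%N then plan_theta P k.+1 else theta')
       (fun k => if (k < N)%N then plan_x P k.+1 else x')
       (fun k => if (k.+1 < N)%N then plan_u P k.+1 else u').

Section Shift.
Context {R : realType} {n m p : nat} (E : empc R n m p).
Context (P : plan R n m p) (theta' : 'rV[R]_p) (u' : 'rV[R]_m).
Hypothesis horizon_gt0 : (0 < horizon E)%N.
Let xN := plan_x P (horizon E).
Let x' := dyn E (xN, u').
Let Q := shift_plan (horizon E) P theta' x' u'.

Lemma feasible_shift_plan x theta :
  feasible E x theta P ->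
  constr E (xN, u') -> term_set E x' -> params E theta' ->
  storage E (theta', x') - storage E (plan_theta P (horizon E), xN)
    + pd_fun E (xN - ss_x E) <= cost E (xN, u') - cost E (ss_x E, ss_u E) ->
  feasible E (plan_x P 1%N) (plan_theta P 1%N) Q.
Proof.
move=> [_ Pstep Pparams _] ZN Xf' Th' dN; split => /=.
- by rewrite horizon_gt0.
- move=> k kN; rewrite kN.
  (* Only the last step, [k.+1 = horizon E], is new; all others are steps of [P] moved by one. *)
  move: (kN); rewrite leq_eqVlt => /orP[/eqP kE|kN1]; last first.
    by rewrite kN1; exact: Pstep.
  by rewrite kE ltnn.
- by move=> k _; case: ifP => // kN; exact: Pparams.
- by rewrite ltnn.
Qed.

Lemma objective_shift_plan :
  objective E Q = objective E P - cost E (plan_x P 0%N, plan_u P 0%N)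
    + (cost E (xN, u') + (term_cost E x' - term_cost E xN)).
Proof.
rewrite /objective /Q /shift_plan /= ltnn /xN.
(* With horizon [M.+1], the new sum without its last term and the old sum without its first share
   the same [M] terms. *)
case: (horizon E) horizon_gt0 => // M _.
rewrite big_nat_recr//= ltnSn ltnn [in RHS]big_nat_recl//=.
under eq_big_nat => k /andP[_ kM] do rewrite ltnS (ltnW kM) ltnS kM.
ring.
Qed.

End Shift.

(** The bound is uniform in [x] and [theta], as it will be used along the moving closed-loop
    state. *)
Lemma objective_lbound (R : realType) (n m p : nat) (E : empc R n m p) :
  compact (constr E) -> {within constr E, continuous (cost E)} ->
  compact (term_set E) -> {within term_set E, continuous (term_cost E)} ->
  exists b, forall x theta P, feasible E x theta P -> b <= objective E P.
Proof.
move=> /within_continuous_lbound cZ /cZ [bl bl_le].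
move=> /within_continuous_lbound cXf /cXf [bV bV_le].
exists (\sum_(0 <= k < horizon E) bl + bV) => x theta P [_ Pstep _ PN].
apply: lerD (bV_le _ PN); apply: ler_sum_nat => k /andP[_ kN].
by have [_ Zk _] := Pstep k kN; exact: bl_le.
Qed.

Theorem theorem15 (R : realType) (n m p : nat)
  (X : set 'rV[R]_n) (U : set 'rV[R]_m) (Z : set ('rV[R]_n * 'rV[R]_m))
  (f : 'rV[R]_n * 'rV[R]_m -> 'rV[R]_n) (l : 'rV[R]_n * 'rV[R]_m -> R)
  (xs : 'rV[R]_n) (us : 'rV[R]_m) (rho : 'rV[R]_n -> R)
  (Theta : set 'rV[R]_p) (lambda : 'rV[R]_p * 'rV[R]_n -> R)
  (Xf : set 'rV[R]_n) (kappa : 'rV[R]_n -> 'rV[R]_m) (Vf : 'rV[R]_n -> R)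
  (N : nat)
  (* system, constraints, cost, horizon *)
  (f_X : forall x u, X x -> U u -> X (f (x, u)))
  (f_cont : {within X `*` U, continuous f})
  (Z_sub : Z `<=` X `*` U)
  (Z_compact : compact Z)
  (l_cont : {within Z, continuous l})
  (s_opt : optimal_steady_state f Z l (xs, us))
  (s_uniq : forall z, optimal_steady_state f Z l z -> z = (xs, us))
  (rho_pd : positive_definite rho)
  (N_ge1 : (1 <= N)%N)
  (* A1, A2 *)
  (Theta_compact : compact Theta)
  (lambda_cont : {within Theta `*` X, continuous lambda})
  (* A3 *)
  (Xf_compact : compact Xf)
  (Xf_sub : Xf `<=` X)
  (xs_int : interior Xf xs)
  (kappa_U : forall x, X x -> U (kappa x))
  (kappa_xs : kappa xs = us)
  (Vf_cont : {within Xf, continuous Vf})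
  (kappa_Z : forall x, Xf x -> Z (x, kappa x))
  (kappa_Xf : forall x, Xf x -> Xf (f (x, kappa x)))
  (Vf_decr : forall x, Xf x ->
     Vf (f (x, kappa x)) - Vf x <= l (xs, us) - l (x, kappa x))
  (* A4 *)
  (lambda_term : forall x theta, Xf x -> Theta theta ->
     exists2 theta', Theta theta' &
       lambda (theta', f (x, kappa x)) - lambda (theta, x)
       <= l (x, kappa x) - l (xs, us) - rho (x - xs)) :
  let E := Empc f Z l xs us rho Theta lambda Xf Vf N in
  forall (x : nat -> 'rV[R]_n) (theta : nat -> 'rV[R]_p)
         (P : nat -> plan R n m p),
    feasible_set X E (x 0%N, theta 0%N) ->
    closed_loop X E x theta P ->
    (limn_esup (fun T : nat =>
       ((\sum_(0 <= t < T) l (plan_x (P t) 0%N, plan_u (P t) 0%N)) / T%:R)%:E)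
     <= (l (xs, us))%:E)%E.
Proof.
move=> E x theta P feas0 loop.
(* One candidate serves twice: its existence gives recursive feasibility, its cost gives the
   descent. *)
have step t : feasible_set X E (x t, theta t) ->
    exists2 Q, feasible E (x t.+1) (theta t.+1) Q &
      objective E Q <= objective E (P t)
        - l (plan_x (P t) 0%N, plan_u (P t) 0%N) + l (xs, us).
  move=> feas; have [/(_ feas)[Pfeas _] -> ->] := loop t.
  have [[Px0 _] Pstep Pparams PN] := Pfeas.
  have [th' Th' dth'] := lambda_term _ _ PN (Pparams N (leqnn _)).
  have [Px1 _ _] := Pstep 0%N N_ge1.
  rewrite -Px0 -Px1.
  exists (shift_plan N (P t) th' (f (plan_x (P t) N, kappa (plan_x (P t) N)))
            (kappa (plan_x (P t) N))).
    apply: feasible_shift_plan Pfeas _ _ _ _ => //=.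
    - exact: kappa_Z.
    - exact: kappa_Xf.
    - by rewrite -lerBrDr.
  rewrite (@objective_shift_plan _ _ _ _ E)//= lerD2l -lerBrDl.
  exact: Vf_decr.
have feas t : feasible_set X E (x t, theta t).
  elim: t => // t feas; have [Q Qfeas _] := step t feas.
  have [/(_ feas)[[[Px0 _] Pstep Pparams _] _] xE thE] := loop t.
  have [_ /Z_sub[/= X0 U0] _] := Pstep 0%N N_ge1.
  (* The first pair of the plan lies in [Z], so its successor stays in [X]; the parameter at index 1
     is constrained because [N >= 1]. *)
  split; last by exists Q.
    by rewrite /= xE -Px0; exact: f_X.
  by rewrite /= thE; exact: Pparams.
have descent t : objective E (P t.+1) <= objective E (P t)
    - l (plan_x (P t) 0%N, plan_u (P t) 0%N) + l (xs, us).
  have [Q Qfeas] := step t (feas t); apply: le_trans.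
  by have [/(_ (feas t.+1))[_ Popt] _ _] := loop t.+1; exact: Popt.
have [b b_le] := @objective_lbound _ _ _ _ E Z_compact l_cont Xf_compact Vf_cont.
apply: (@limn_esup_average_le _ _ _ (objective E (P 0%N) - b)) => T.
have {}b_le : b <= objective E (P T).
  by have [/(_ (feas T))[Pfeas _] _ _] := loop T; exact: b_le Pfeas.
(* The induction keeps [objective E (P T)] instead of its bound [b], so that consecutive values
   cancel. *)
suff : \sum_(0 <= t < T) l (plan_x (P t) 0%N, plan_u (P t) 0%N)
    <= T%:R * l (xs, us) + (objective E (P 0%N) - objective E (P T)).
  by move=> /le_trans; apply; rewrite !lerD2l lerN2.
elim: T {b_le} => [|T IH]; first by rewrite big_geq// mul0r add0r subrr.
rewrite big_nat_recr//= -natr1.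
by have := descent T; lra.
Qed.
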